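(* Let $R$ be a ring. Any homomorphic image of a cl.Hilbert $R$-module is a cl.Hilbert $R$-module.
   Context: All rings are commutative with identity $1\neq 0$ and all modules are unital. A proper submodule $P$ of an $R$-module $M$ is classical prime if for all $a,b\in R$ and $m\in M$, $abm\in P$ implies $am\in P$ or $bm\in P$. An $R$-module $M$ is a cl.Hilbert module (classical Hilbert module) if every classical prime submodule of $M$ is an intersection of maximal submodules of $M$. *)

(* Defs.v *)
From mathcomp Require Export all_boot all_algebra.
From mathcomp Require Export boolp classical_sets functions.

Set Implicit Arguments.
Unset Strict Implicit.
Unset Printing Implicit Defensive.

Local Open Scope ring_scope.
Local Open Scope classical_set_scope.

(* Submodules are arbitrary subsets [set M]; [mem] turns such a subset into the
   boolean predicate expected by [GRing.submod_closed], via classical logic. *)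
Definition submodule (R : comNzRingType) (M : lmodType R) (P : set M) : Prop :=
  GRing.submod_closed (mem P).

Definition proper_submodule (R : comNzRingType) (M : lmodType R) (P : set M) :
    Prop :=
  submodule P /\ P <> setT.

Definition classical_prime (R : comNzRingType) (M : lmodType R) (P : set M) :
    Prop :=
  proper_submodule P /\
  forall (a b : R) (m : M), P ((a * b) *: m) -> P (a *: m) \/ P (b *: m).

Definition maximal_submodule (R : comNzRingType) (M : lmodType R) (Q : set M) :
    Prop :=
  proper_submodule Q /\
  forall L : set M, proper_submodule L -> Q `<=` L -> L = Q.

(* The family [F] may be infinite; it is automatically nonempty when its
   intersection is a proper submodule. *)
Definition cl_Hilbert (R : comNzRingType) (M : lmodType R) : Prop :=
  forall P : set M, classical_prime P ->
    exists F : set (set M),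
      F `<=` [set Q | maximal_submodule Q] /\ P = \bigcap_(Q in F) Q.

(* Main.v *)
(* By the correspondence theorem: along a surjection [f : M -> N], preimages of
   classical prime submodules are classical prime, and images of maximal
   submodules containing the kernel are maximal. So a representation of
   [f @^-1` P] as an intersection of maximal submodules, each of which contains
   the kernel, is carried by [f] to one of [P]. *)
Require Import Defs.
From mathcomp Require Import all_boot all_algebra.
From mathcomp Require Import boolp classical_sets functions.

Import GRing.Theory.

Local Open Scope ring_scope.
Local Open Scope classical_set_scope.

Lemma submoduleP (R : comNzRingType) (M : lmodType R) (P : set M) :
  submodule P <->
  P 0 /\ forall (a : R) (u v : M), P u -> P v -> P (a *: u + v).
Proof.
split=> [[P0 Plin]|[P0 Plin]].
  split=> [|a u v Pu Pv]; first exact: set_mem P0.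
  by apply: set_mem; apply: (Plin a u v); apply: mem_set.
split; first exact: mem_set.
by move=> a u v Pu Pv; apply: mem_set; apply: Plin; apply: set_mem.
Qed.

Lemma submodule_preimage (R : comNzRingType) (M N : lmodType R)
    (f : {linear M -> N}) (P : set N) :
  submodule P -> submodule (f @^-1` P).
Proof.
case/submoduleP=> P0 Plin; apply/submoduleP; rewrite /preimage /=.
split=> [|a u v Pu Pv]; first by rewrite linear0.
by rewrite linearP; apply: Plin.
Qed.

Lemma submodule_image (R : comNzRingType) (M N : lmodType R)
    (f : {linear M -> N}) (Q : set M) :
  submodule Q -> submodule (f @` Q).
Proof.
case/submoduleP=> Q0 Qlin; apply/submoduleP.
split=> [|a _ _ [u Qu <-] [v Qv <-]]; first by exists 0; rewrite ?linear0.
by exists (a *: u + v); [exact: Qlin | rewrite linearP].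
Qed.

(** If [f m = f q] with [q] in [Q], then [m - q] lies in the kernel, hence in [Q], and so does
    [m]. *)
Lemma preimage_image_submodule (R : comNzRingType) (M N : lmodType R)
    (f : {linear M -> N}) (Q : set M) :
  submodule Q -> f @^-1` [set 0] `<=` Q -> f @^-1` (f @` Q) = Q.
Proof.
move=> sQ kerQ; rewrite eqEsubset; split=> [m [q Qq fqm]|]; last first.
  exact: preimage_image.
have [_ Qlin] := (submoduleP _ _ _).1 sQ.
(* Write [m] as [1 *: q + (m - q)] to match the shape of [Qlin]. *)
rewrite -[m](subrKC q) -[q in q + _]scale1r; apply: Qlin => //.
by apply: kerQ; rewrite /preimage /= linearB fqm subrr.
Qed.

Lemma proper_submodule_preimage (R : comNzRingType) (M N : lmodType R)
    (f : {linear M -> N}) (f_surj : set_surj setT setT f) (P : set N) :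
  proper_submodule P -> proper_submodule (f @^-1` P).
Proof.
case=> sP PnT; split; first exact: submodule_preimage.
move=> fPT; apply: PnT; rewrite -subTset => n _.
have [m _ <-] := f_surj n I.
by have : (f @^-1` P) m by rewrite fPT.
Qed.

Lemma classical_prime_preimage (R : comNzRingType) (M N : lmodType R)
    (f : {linear M -> N}) (f_surj : set_surj setT setT f) (P : set N) :
  classical_prime P -> classical_prime (f @^-1` P).
Proof.
case=> pP prP; split; first exact: proper_submodule_preimage.
by move=> a b m; rewrite /preimage /= !linearZ; apply: prP.
Qed.

Lemma maximal_submodule_image (R : comNzRingType) (M N : lmodType R)
    (f : {linear M -> N}) (f_surj : set_surj setT setT f) (Q : set M) :
  f @^-1` [set 0] `<=` Q -> maximal_submodule Q -> maximal_submodule (f @` Q).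
Proof.
move=> kerQ [[sQ QnT] maxQ].
have fK := preimage_image_submodule _ _ _ _ _ sQ kerQ.
split=> [|L pL fQL].
  split; first exact: submodule_image.
  by move=> fQT; apply: QnT; rewrite -fK fQT preimage_setT.
(* [L] pulls back to a proper submodule containing [Q], hence to [Q] itself; it remains to see that
   [L] is the image of its own preimage, by surjectivity. *)
rewrite -(maxQ (f @^-1` L)); last 2 first.
- exact: proper_submodule_preimage.
- by rewrite -fK; apply: preimage_subset.
rewrite eqEsubset; split; last exact: image_preimage_subset.
by move=> n Ln; have [m _ fm] := f_surj n I; exists m; rewrite // /preimage /= fm.
Qed.

Theorem proposition2p6 (R : comNzRingType) (M N : lmodType R)
    (f : {linear M -> N}) (f_surj : set_surj setT setT f) :
  cl_Hilbert M -> cl_Hilbert N.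
Proof.
move=> HM P cP.
have [F [Fmax fPF]] := HM _ (classical_prime_preimage _ _ _ _ f_surj _ cP).
have PF Q : F Q -> f @^-1` P `<=` Q by move=> FQ; rewrite fPF; exact: bigcap_inf.
(* Since [P] contains [0], its preimage contains the kernel, and each [Q] in [F] contains that
   preimage. *)
have kerF Q : F Q -> f @^-1` [set 0] `<=` Q.
  move=> FQ m fm0; apply: (PF Q FQ); rewrite /preimage /= fm0.
  by have [[/submoduleP[]]] := cP.
exists [set f @` Q | Q in F]; split=> [_ [Q FQ <-]|].
  by apply: maximal_submodule_image => //; [exact: kerF | exact: Fmax].
rewrite eqEsubset; split=> n.
  move=> Pn _ [Q FQ <-]; have [m _ fm] := f_surj n I.
  by exists m => //; apply: (PF Q FQ); rewrite /preimage /= fm.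
have [m _ <-] := f_surj n I; move=> capm.
(* Lifting to [M] reduces the goal to [m] lying in every [Q] of [F]; as [Q] contains the kernel,
   this follows from [f m] lying in the image of [Q]. *)
suff : (f @^-1` P) m by [].
rewrite fPF => Q FQ; have [[sQ _] _] := Fmax _ FQ.
rewrite -(preimage_image_submodule _ _ _ f _ sQ (kerF _ FQ)).
by apply: capm; exists Q.
Qed.
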